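(* Let $N_i\ge1$ and, for $j=1,\ldots,N_i$, let $\lambda_{ij}>0$ and $\delta_{ij}\ge0$ with $\lambda_{ij}\delta_{ij}<1$; let $\Delta_i=\sum_{j=1}^{N_i}\delta_{ij}>0$. Consider a CTMC fragment consisting of states $z_{i1},\ldots,z_{ik_i}$ followed by states $s'_{i1},\ldots,s'_{iN_i}$, in which $z_{il}$ transitions to $z_{i,l+1}$ ($l<k_i$) and $z_{ik_i}$ transitions to $s'_{i1}$, each with rate $\lambda_i^E$, and $s'_{ij}$ is left with total rate $\lambda'_{ij}$ (to $s'_{i,j+1}$ for $j<N_i$). Let $\epsilon\in(0,1)$. If $k_i$, $\lambda_i^E$ and $\lambda'_{i1},\ldots,\lambda'_{iN_i}$ satisfy, for some $p\in(0,1)$, (a) $1-\sum_{l=0}^{k_i-1}\frac{(k_i(1-\epsilon))^l e^{-k_i(1-\epsilon)}}{l!}=p$, (b) $\lambda_i^E=k_i/\Delta_i$, (c) $\lambda'_{ij}=\frac{\lambda_{ij}}{1-\lambda_{ij}\delta_{ij}}$ for all $j\in\{1,\ldots,N_i\}$, then: (i) the probability that the CTMC leaves state $z_{ik_i}$ within $\Delta_i(1-\epsilon)$ time units from entering state $z_{i1}$ is $p$; (ii) the expected time for the CTMC to leave $s'_{iN_i}$ after entering $z_{i1}$ is $\sum_{j=1}^{N_i}\lambda_{ij}^{-1}$, which equals the expected time to traverse a sequence of states $s_{i1},\ldots,s_{iN_i}$ with exponential sojourn times of rates $\lambda_{i1},\ldots,\lambda_{iN_i}$.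
   Context: In the paper, $\lambda_{ij}$ is the reciprocal of the mean of the observed execution times of the component associated with high-level CTMC state $s_{ij}$, and $\delta_{ij}$ (its delay) is the minimum observed execution time of that component; the states $s_{i1},\ldots,s_{iN_i}$ form a sequence of high-level states always traversed consecutively, and $\Delta_i$ is their joint delay. The states $z_{i1},\ldots,z_{ik_i}$ encode an Erlang-$k_i$ distribution with rate $\lambda_i^E$ (CDF $F(k,\lambda,x)=1-\sum_{l=0}^{k-1}\frac{(\lambda x)^l}{l!}e^{-\lambda x}$). *)

(* Defs.v *)
From HB Require Import structures.
From mathcomp Require Import all_boot all_order all_algebra.
From mathcomp Require Import all_classical all_reals all_analysis.
Set Implicit Arguments. Unset Strict Implicit. Unset Printing Implicit Defensive.
Import Order.TTheory GRing.Theory Num.Theory.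
Local Open Scope classical_set_scope.
Local Open Scope ring_scope.

Definition is_exponential (R : realType) (d : measure_display)
  (T : measurableType d) (P : probability T R) (X : T -> R) (rate : R) : Prop :=
  forall A : set R, measurable A ->
    P (X @^-1` A) = exponential_prob rate A.

Definition mutually_independent (R : realType) (d : measure_display)
  (T : measurableType d) (P : probability T R) (n : nat)
  (X : 'I_n -> T -> R) : Prop :=
  forall B : 'I_n -> set R, (forall i, measurable (B i)) ->
    P (\bigcap_(i in [set: 'I_n]) (X i @^-1` B i)) =
    (\prod_(i < n) fine (P (X i @^-1` B i)))%:E.

(* concatenation of the k sojourn times in z_{i1..ik} and the N sojourn
   times in s'_{i1..iN}, as one family indexed by 'I_(k+N) *)
Definition concat_family (T R : Type) (k N : nat)
  (Z : 'I_k -> T -> R) (S : 'I_N -> T -> R) : 'I_(k + N) -> T -> R :=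
  fun i => match fintype.split i with inl a => Z a | inr b => S b end.

(* Main.v *)
(* The partial sum S_n of independent variables X_0, X_1, ... is independent of
   every event determined by X_n, X_(n+1), ..., by induction on n: the joint law of
   (X_n, S_n), restricted to such an event, agrees with a product measure on
   rectangles, hence everywhere.  This gives
     P(S_(n+1) <= x) = \int P(S_n <= x - z) law_(X_n)(dz),
   and for exponential X_n the right-hand side is computed from the Erlang
   distribution function of S_n by an explicit primitive, so S_k has the Erlang
   distribution function; with lamE = k / Delta, its value at Delta (1 - eps) is (a).
   For the means only linearity of expectation is needed:
   k / lamE = Delta = \sum_j del_j and 1 / lam'_j = 1 / lam_j - del_j. *)
Require Import Defs.
From HB Require Import structures.
From mathcomp Require Import all_boot all_order all_algebra.
From mathcomp Require Import all_classical all_reals all_analysis.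
From mathcomp Require Import measurable_realfun.
From mathcomp Require Import ring.
Import Order.TTheory GRing.Theory Num.Theory.
Import numFieldNormedType.Exports.
Local Open Scope classical_set_scope.
Local Open Scope ring_scope.

(** * Integration against a density, and joint laws of pairs *)

(** [f] and the Radon-Nikodym derivative of [nu] have the same integral over every measurable set,
    so they agree almost everywhere for [mu]. *)
Lemma integral_density (d : measure_display) (T : measurableType d)
    (R : realType) (nu : {finite_measure set T -> \bar R})
    (mu : {sigma_finite_measure set T -> \bar R}) (f : T -> R) :
  mu.-integrable setT (EFin \o f) ->
  (forall A, measurable A -> nu A = (\int[mu]_(x in A) (f x)%:E)%E) ->
  forall g : T -> \bar R, nu.-integrable setT g ->
  (\int[nu]_x g x = \int[mu]_x (g x * (f x)%:E))%E.
Proof.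
move=> intf nuE g intg.
have mf := measurable_int _ intf.
have mg := measurable_int _ intg.
have dom : nu `<< mu.
  apply/null_content_dominatesP => A mA muA0.
  by rewrite nuE// null_set_integral//; exact: (measurable_funS measurableT).
rewrite -(Radon_Nikodym_change_of_variables dom)//.
have iRN := @Radon_Nikodym_integrable _ _ _ (charge_of_finite_measure nu) mu dom.
apply: ae_eq_integral => //.
- by apply: emeasurable_funM => //; exact: (measurable_int mu).
- exact: emeasurable_funM.
- apply: ae_eqe_mul2l; apply: integral_ae_eq => // A _ mA.
  by rewrite -Radon_Nikodym_integral//= -nuE.
Qed.

(** Both sides are measures in [C] that agree on rectangles; uniqueness of the product measure
    applies once the factor [P G] is absorbed into the law of [Y]. *)
Lemma joint_law (d : measure_display) (T : measurableType d) (R : realType)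
    (P : probability T R) (X Y : {RV P >-> R}) (G : set T) :
  measurable G ->
  (forall A B : set R, measurable A -> measurable B ->
    P (X @^-1` A `&` (Y @^-1` B `&` G)) =
    (P (X @^-1` A) * (P (Y @^-1` B) * P G))%E) ->
  forall C : set (R * R), measurable C ->
  P ((fun w => (X w, Y w)) @^-1` C `&` G) =
    ((\int[distribution P X]_x P (Y @^-1` xsection C x)) * P G)%E.
Proof.
move=> mG indep C mC.
have mXY : measurable_fun setT (fun w => (X w, Y w)) by exact: measurable_fun_pair.
pose c : {nonneg R} := NngNum (fine_ge0 (measure_ge0 P G)).
have cE : (c%:num%:E = P G)%E by rewrite /= fineK// fin_num_measure.
pose m' := (pushforward (mrestr P mG) (fun w => (X w, Y w)) :
  {measure set (R * R) -> \bar R}).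
transitivity (m' mXY C) => //.
rewrite -(product_measure_unique
  (m1 := distribution P X) (m2 := mscale c (distribution P Y)))//; last first.
  move=> A B mA mB.
  transitivity (P (X @^-1` A `&` (Y @^-1` B `&` G))); first by rewrite setIA.
  by rewrite indep//; congr (_ * _)%E; rewrite -cE muleC.
rewrite /product_measure1 -cE -ge0_integralZr//=.
- by apply: eq_integral => x _; rewrite /mscale/= muleC.
- by have := measurable_fun_xsection (distribution P Y) mC.
- by rewrite lee_fin fine_ge0.
Qed.

(** * Independence of partial sums from the later variables *)

Section partial_sums.
Context (d : measure_display) (T : measurableType d) (R : realType)
  (P : probability T R) (m : nat).
Variable X : 'I_m -> {RV P >-> R}.
Hypothesis indX : mutually_independent P (fun i => X i : T -> R).

(** Rectangular events suffice, since the induction splits off one coordinate at a time. *)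
Definition tail_event (n : nat) (B : 'I_m -> set R) : set T :=
  [set w | forall i : 'I_m, (n <= i)%N -> B i (X i w)].

Definition partial_sum (n : nat) : {RV P >-> R} := \sum_(i < m | (i < n)%N) X i.

Lemma partial_sumE n w : partial_sum n w = \sum_(i < m | (i < n)%N) X i w.
Proof.
by rewrite /partial_sum; elim/big_rec2: _ => // i y1 y2 _ <-.
Qed.

(** With [setT] at the coordinates below [n], a tail event becomes an intersection over all indices,
    the form [indX] speaks of. *)
Let mask n (B : 'I_m -> set R) : 'I_m -> set R :=
  fun i => if (n <= i)%N then B i else setT.

Let tail_eventE n B :
  tail_event n B = \bigcap_(i in [set: 'I_m]) (X i @^-1` mask n B i).
Proof.
apply/seteqP; split => w /= h i; first by move=> _; rewrite /mask /=; case: ifPn => // /h.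
by move=> ni; have := h i Logic.I; rewrite /mask /= ni.
Qed.

Let mmask n B : (forall i, measurable (B i)) -> forall i, measurable (mask n B i).
Proof. by move=> mB i; rewrite /mask; case: ifP. Qed.

Lemma measurable_tail_event n B :
  (forall i, measurable (B i)) -> measurable (tail_event n B).
Proof.
move=> mB; rewrite tail_eventE; apply: fin_bigcap_measurable => // i _.
by apply: measurable_funPTI; exact: mmask.
Qed.

Lemma prob_tail_event n B : (forall i, measurable (B i)) ->
  P (tail_event n B) = (\prod_(i < m | (n <= i)%N) fine (P (X i @^-1` B i)))%:E.
Proof.
move=> mB; rewrite tail_eventE indX; last exact: mmask.
congr EFin; rewrite [RHS]big_mkcond/=; apply: eq_bigr => i _.
by rewrite /mask; case: ifP => // _; rewrite preimage_setT probability_setT.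
Qed.

Lemma tail_event_recl n (nm : (n < m)%N) (B : 'I_m -> set R) :
  tail_event n B =
    X (Ordinal nm) @^-1` B (Ordinal nm) `&` tail_event n.+1 B.
Proof.
apply/seteqP; split => w /=.
  by move=> h; split; [exact: h|move=> i /ltnW; exact: h].
move=> [h0 h] i; rewrite leq_eqVlt => /predU1P[ni|]; last exact: h.
by have <- : Ordinal nm = i by exact: val_inj.
Qed.

Lemma prob_tail_event_recl n (nm : (n < m)%N) (B : 'I_m -> set R) :
  (forall i, measurable (B i)) ->
  P (tail_event n B) =
    (P (X (Ordinal nm) @^-1` B (Ordinal nm)) * P (tail_event n.+1 B))%E.
Proof.
move=> mB; rewrite !prob_tail_event// (bigD1 (Ordinal nm))//= EFinM fineK; last first.
  by rewrite fin_num_measure//; exact: measurable_funPTI.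
congr (_ * _%:E)%E; apply: eq_bigl => i.
by rewrite ltn_neqAle andbC eq_sym.
Qed.

Let upd n (nm : (n < m)%N) (B : 'I_m -> set R) A : 'I_m -> set R :=
  fun i => if i == Ordinal nm then A else B i.

Let tail_upd n (nm : (n < m)%N) B A :
  tail_event n.+1 (upd n nm B A) = tail_event n.+1 B.
Proof.
by apply/seteqP; split => w h i ni; have := h i ni; rewrite /upd;
  case: eqP => // iE; move: ni; rewrite iE/= ltnn.
Qed.

Lemma partial_sumS n (nm : (n < m)%N) w :
  partial_sum n.+1 w = X (Ordinal nm) w + partial_sum n w.
Proof.
rewrite !partial_sumE (bigD1 (Ordinal nm))//=; congr (_ + _).
by apply: eq_bigl => i; rewrite [RHS]ltn_neqAle andbC -[(i <= n)%N]ltnS.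
Qed.

(** Placing a set at coordinate [n] of the tail event turns the hypothesis at [n] into the
    factorisation required by [joint_law]. *)
Let convolution_tail n (nm : (n < m)%N) :
  (forall (A : set R) (B : 'I_m -> set R), measurable A ->
    (forall i, measurable (B i)) ->
    P (partial_sum n @^-1` A `&` tail_event n B) =
      (P (partial_sum n @^-1` A) * P (tail_event n B))%E) ->
  forall (A : set R) (B : 'I_m -> set R), measurable A ->
  (forall i, measurable (B i)) ->
  P (partial_sum n.+1 @^-1` A `&` tail_event n.+1 B) =
    ((\int[distribution P (X (Ordinal nm))]_x
        P (partial_sum n @^-1` [set s | A (x + s)%R])) * P (tail_event n.+1 B))%E.
Proof.
move=> IH A B mA mB.
pose C := [set z : R * R | A (z.1 + z.2)].
have mC : measurable C.
  rewrite -[C]setTI; apply: measurable_funD => //.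
have -> : partial_sum n.+1 @^-1` A =
    (fun w => (X (Ordinal nm) w, partial_sum n w)) @^-1` C.
  by apply/seteqP; split => w /=; rewrite partial_sumS.
rewrite joint_law//; first last.
- move=> A1 A2 mA1 mA2.
  have mB' i : measurable (upd n nm B A1 i) by rewrite /upd; case: ifP.
  have := IH A2 _ mA2 mB'.
  rewrite (prob_tail_event_recl n nm)// tail_event_recl tail_upd.
  by rewrite {1 2}/upd eqxx setICA muleCA.
- exact: measurable_tail_event.
congr (_ * _)%E; apply: eq_integral => x _; congr (P _).
by apply/seteqP; split => w /=; rewrite /xsection/= inE.
Qed.

Lemma tail_eventT n : tail_event n (fun=> setT) = setT.
Proof. by apply/seteqP; split. Qed.

Lemma partial_sum_indep n : (n <= m)%N ->
  forall (A : set R) (B : 'I_m -> set R), measurable A ->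
  (forall i, measurable (B i)) ->
  P (partial_sum n @^-1` A `&` tail_event n B) =
    (P (partial_sum n @^-1` A) * P (tail_event n B))%E.
Proof.
elim: n => [_ A B mA mB|n IH nm A B mA mB].
  have S0 w : partial_sum 0 w = 0 by rewrite partial_sumE big_pred0.
  have [A0|A0] := pselect (A 0).
    have -> : partial_sum 0 @^-1` A = setT.
      by apply/seteqP; split => w //= _; rewrite S0.
    by rewrite setTI probability_setT mul1e.
  have -> : partial_sum 0 @^-1` A = set0.
    by apply/seteqP; split => w //=; rewrite S0.
  by rewrite set0I measure0 mul0e.
(* Used twice: for [B], and for [setT] everywhere, which identifies the integral as the probability
   for the sum alone. *)
have conv := convolution_tail n nm (IH (ltnW nm)) A.
rewrite conv//; congr (_ * _)%E.
have := conv (fun=> setT) mA (fun=> measurableT).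
by rewrite tail_eventT setIT probability_setT mule1 => ->.
Qed.

Lemma prob_partial_sumS n (nm : (n < m)%N) (A : set R) : measurable A ->
  P (partial_sum n.+1 @^-1` A) =
    (\int[distribution P (X (Ordinal nm))]_x
        P (partial_sum n @^-1` [set s | A (x + s)%R]))%E.
Proof.
move=> mA.
have := convolution_tail n nm (partial_sum_indep n (ltnW nm)) A
  (fun=> setT) mA (fun=> measurableT).
by rewrite tail_eventT setIT probability_setT mule1.
Qed.

End partial_sums.
Arguments partial_sum {d T R P m} X n.

(** * Tail and mean of the exponential law *)

Lemma exponential_prob_itvcy (R : realType) (rate r : R) : 0 < rate -> 0 <= r ->
  exponential_prob rate `[r, +oo[ = (expR (- rate * r))%:E.
Proof.
move=> rate0 r0.
have cF : continuous (fun x : R => - expR (- rate * x)).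
  move=> x; apply: differentiable_continuous.
  exact/derivable1_diffP/ex_derive.
rewrite /exponential_prob (@ge0_continuous_FTC2y _ _
  (fun x => - expR (- rate * x)) _ 0)//.
- by rewrite sub0e EFinN oppeK.
- by move=> x _; apply: exponential_pdf_ge0; exact: ltW.
- apply: (@continuous_subspaceW R^o _ _ [set` `[0, +oo[%R]).
    by apply: subset_itvr; rewrite bnd_simp.
  exact: within_continuous_exponential_pdf.
- rewrite -oppr0; apply: cvgN.
  rewrite (_ : (fun x => expR (- rate * x)) =
    (fun z => expR (- z)) \o (fun z => rate * z)); last first.
    by apply/funext => x /=; rewrite mulNr.
  apply: (@cvg_comp _ _ _ _ _ _ (pinfty_nbhs R)); last exact: cvgr_expR.
  exact: gt0_cvgMry.
- by apply: cvg_at_right_filter; exact: cF.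
- move=> z /[!in_itv]/= /[!andbT] rz; apply: derive1_exponential_pdf.
  by rewrite in_itv/= andbT (le_lt_trans r0).
Qed.

Lemma exponential_prob_lt0 (R : realType) (rate : R) :
  exponential_prob rate `]-oo, 0[ = 0%E.
Proof.
rewrite /exponential_prob integral0_eq// => x /=; rewrite in_itv/= => x0.
by rewrite lt0_exponential_pdf.
Qed.

Lemma integral_expR_itv0y (R : realType) (rate : R) : 0 < rate ->
  (\int[lebesgue_measure]_(x in `[0%R, +oo[) (expR (- rate * x))%:E
    = (rate^-1)%:E)%E.
Proof.
move=> rate0.
transitivity (\int[lebesgue_measure]_(x in `[0%R, +oo[)
    ((rate^-1)%:E * (exponential_pdf rate x)%:E))%E.
  apply: eq_integral => x; rewrite inE/= in_itv/= andbT => x0.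
  by rewrite exponential_pdfE// -EFinM mulKf// gt_eqF.
rewrite ge0_integralZl//=.
- by have := exponential_prob_itvcy _ rate 0 rate0 (lexx 0);
    rewrite mulr0 expR0 /exponential_prob => ->; rewrite mule1.
- apply/measurable_EFinP; apply: measurable_funTS.
  exact: measurable_exponential_pdf.
- by move=> x _; rewrite lee_fin exponential_pdf_ge0// ltW.
- by rewrite lee_fin invr_ge0 ltW.
Qed.

(** The mean of the positive part is the integral over [r >= 0] of the tail [expR (- rate * r)], and
    [X] equals its positive part almost surely. *)
Lemma exponential_expectation (d : measure_display) (T : measurableType d)
    (R : realType) (P : probability T R) (X : {RV P >-> R}) (rate : R) :
  0 < rate -> is_exponential P X rate ->
  (X : T -> R) \in Lfun P 1 /\ ('E_P[X] = (rate^-1)%:E)%E.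
Proof.
move=> rate0 expX.
(* [X] is only almost surely nonnegative, while the tail formula needs [0 <= X] *)
have mY : measurable_fun setT (fun w => Num.max (X w) 0).
  exact: measurable_maxr.
pose Y : {RV P >-> R} := mfun_Sub (mem_set mY).
have YE w : Y w = Num.max (X w) 0 by [].
have Y0 w : 0 <= Y w by rewrite YE le_max lexx orbT.
have EY : ('E_P[Y] = (rate^-1)%:E)%E.
  rewrite ge0_expectation_ccdf//.
  rewrite -integral_expR_itv0y//; apply: eq_integral => r.
  rewrite inE/= in_itv/= andbT => r0.
  (* The tail formula uses the strict event [r < Y w], so the closed half-line is replaced by the
     open one. *)
  rewrite -exponential_prob_itvcy// /exponential_prob -integral_itv_obnd_cbnd//.
    rewrite -[RHS]/(exponential_prob rate `]r, +oo[%classic) -expX//.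
    congr (P _); apply/seteqP; split => w /=; rewrite !in_itv/= !andbT lt_max;
      last by move=> ->.
    by case/orP => //; rewrite ltNge r0.
  apply/measurable_EFinP; apply: measurable_funTS.
  exact: measurable_exponential_pdf.
have aeXY : {ae P, forall w, Y w = X w}.
  exists (X @^-1` `]-oo, 0[); split.
  - exact: measurable_funPTI.
  - by rewrite expX// exponential_prob_lt0.
  - move=> w /= h; rewrite in_itv/= ltNge; apply/negP => X0; apply: h.
    by apply/max_idPl.
have mX : measurable_fun setT (EFin \o X) by exact/measurable_EFinP.
have mYE : measurable_fun setT (EFin \o Y) by exact/measurable_EFinP.
split.
  apply/Lfun1_integrable/integrableP; split => //.
  rewrite (_ : integral _ _ _ = (rate^-1)%:E%E) ?ltry//.
  rewrite -EY expectation_def; apply: ge0_ae_eq_integral => //.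
  - exact: measurableT_comp.
  - by move=> w _; rewrite lee_fin Y0.
  - by move: aeXY; apply: filterS => w YX _ /=; rewrite -[in LHS]YX ger0_norm.
rewrite -EY !expectation_def; apply: ae_eq_integral => //.
by move: aeXY; apply: filterS => w /= -> _.
Qed.

(** Integrability is part of the conclusion so that two such sums can be added by linearity. *)
Lemma expectation_sum_exponential (d : measure_display) (T : measurableType d)
    (R : realType) (P : probability T R) (n : nat) (X : 'I_n -> {RV P >-> R})
    (rate : 'I_n -> R) :
  (forall i, 0 < rate i) -> (forall i, is_exponential P (X i) (rate i)) ->
  (fun w => \sum_(i < n) X i w) \in Lfun P 1 /\
  ('E_P[(fun w => \sum_(i < n) X i w)%R] = (\sum_(i < n) (rate i)^-1)%:E)%E.
Proof.
move=> rate0 expX.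
have hX i := exponential_expectation _ _ _ _ _ _ (rate0 i) (expX i).
have -> : (fun w => \sum_(i < n) X i w) = \sum_(i < n) (X i : T -> R).
  by apply/funext => w; rewrite fct_sumE.
split; first by apply: rpred_sum => i _; have [] := hX i.
have := @expectation_sum _ _ _ P [seq (X i : T -> R) | i <- index_enum 'I_n].
rewrite !big_map => ->; last by move=> _ /mapP[i _ ->]; have [] := hX i.
by rewrite -sumEFin; apply: eq_bigr => i _; have [] := hX i.
Qed.

(** * Erlang distribution functions and their convolution with an exponential density *)

(** Meant for [0 <= x]; at [n = 0] it is constantly 1, as for the unit mass at 0. *)
Definition erlang_cdf {R : realType} (n : nat) (rate x : R) : R :=
  1 - \sum_(l < n) ((rate * x) ^+ l * expR (- (rate * x)) / (l`!)%:R).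

Section erlang_convolution.
Context (R : realType) (rate x : R).

(** Differentiation lowers the index: the derivative of [g l.+1] is [- rate * g l]. The form by
    function operations lets derivatives be inferred. *)
Let g (l : nat) : R -> R := (l`!)%:R^-1 \*: (rate \*: (cst x - id)) ^+ l.

Let gE l z : g l z = (rate * (x - z)) ^+ l / (l`!)%:R.
Proof. by rewrite /g /= mulrC exprfctE. Qed.

Let is_derive_g l (z : R) : is_derive z (1 : R) (g l.+1) (- (rate * g l z)).
Proof.
apply: is_derive_eq; rewrite /= gE /GRing.scale/= sub0r mulrN1.
rewrite factS natrM invfM.
have l0 : l.+1%:R != 0 :> R by rewrite pnatr_eq0.
have f0 : (l`!)%:R != 0 :> R by rewrite pnatr_eq0 -lt0n fact_gt0.
by field; rewrite addrC natr1 f0 l0.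
Qed.

Let derivable_g l (z : R) : derivable (g l) z 1.
Proof.
case: l => [|l]; last exact: ex_derive.
by rewrite /g expr0; exact: ex_derive.
Qed.

(* [f n z = erlang_cdf n rate (x - z) * (rate * expR (- rate * z))], and [F n] is its
   primitive *)
Let f n : R -> R := rate \*: (expR \o (- rate \*: id)) -
  (expR (- (rate * x)) * rate) \*: \sum_(l < n) g l.

Let F n : R -> R := - (expR \o (- rate \*: id)) +
  expR (- (rate * x)) \*: \sum_(l < n) g l.+1.

Let is_derive_F n (z : R) : is_derive z (1 : R) (F n) (f n z).
Proof.
have dexp : is_derive z (1 : R) (expR \o (- rate \*: id))
    (- (rate * expR (- rate * z))).
  by apply: is_derive_eq; rewrite /= [_%:A]mulr1 mulrN mulrC.
have dsum := is_derive_sum (fun l : 'I_n => is_derive_g l z).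
apply: (is_derive_eq (is_deriveD (is_deriveN dexp) (is_deriveZ _ dsum))).
rewrite opprK /f; congr (_ + _).
rewrite sumrN -mulr_sumr scalerN /GRing.scale/= mulrA; congr (- (_ * _)).
by rewrite fct_sumE.
Qed.

Let continuous_f n : continuous (f n).
Proof.
move=> z; apply: differentiable_continuous; apply/derivable1_diffP.
apply: derivableB; first exact: ex_derive.
by apply: derivableZ; apply: derivable_sum => l; exact: derivable_g.
Qed.

Lemma erlang_convolution n : 0 <= x ->
  (\int[lebesgue_measure]_(z in `[0%R, x])
     (erlang_cdf n rate (x - z) * (rate * expR (- rate * z)))%:E =
  (erlang_cdf n.+1 rate x)%:E)%E.
Proof.
rewrite le_eqVlt => /predU1P[<-|x0].
  rewrite set_itv1 integral_set1 /erlang_cdf mulr0 oppr0 expR0 big_ord_recl.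
  rewrite big1 ?addr0 ?expr0 ?mulr1 ?fact0 ?invr1 ?mulr1 ?subrr// => i _.
  by rewrite lift0 expr0n !mul0r.
transitivity (\int[lebesgue_measure]_(z in `[0%R, x]) (f n z)%:E)%E.
  apply: eq_integral => z _; congr EFin.
  rewrite /f /erlang_cdf mulrBl mul1r; congr (_ - _).
  rewrite [RHS]/= fct_sumE mulr_suml [RHS]mulr_sumr; apply: eq_bigr => l _.
  (* The two exponentials multiply to [expR (- (rate * x))], free of [z], which leaves a polynomial
     in [z]. *)
  rewrite gE (_ : - (rate * x) = - (rate * (x - z)) + - rate * z); last by ring.
  by rewrite expRD; ring.
rewrite (continuous_FTC2 (F := F n) x0); last 3 first.
- exact/continuous_subspaceT/continuous_f.
- have cF : continuous (F n).
    move=> z; apply: differentiable_continuous; apply/derivable1_diffP.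
    by have [] := is_derive_F n z.
  split => [z _|//|//].
  + by have [] := is_derive_F n z.
  + by apply: cvg_at_right_filter; exact: cF.
  + by apply: cvg_at_left_filter; exact: cF.
- by move=> z _; rewrite derive1E; have [_ ->] := is_derive_F n z.
rewrite -EFinB; congr EFin.
have FE z : F n z = - expR (- rate * z) +
    expR (- (rate * x)) * \sum_(l < n) g l.+1 z by rewrite /F [LHS]/= fct_sumE.
(* At [z = x] every [g l.+1] vanishes; at [z = 0] they give the Erlang terms of index 1 to [n], and
   the term of index 0 comes from [- expR (- rate * x)]. *)
rewrite !FE [in X in X - _]big1 => [|l _]; last first.
  by rewrite gE subrr mulr0 expr0n mul0r.
rewrite /erlang_cdf big_ord_recl fact0 expr0 !mulr0 expR0 addr0 mulNr.
rewrite mul1r divr1 opprD opprK addrCA -opprD; congr (_ - (_ + _)).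
rewrite mulr_sumr; apply: eq_bigr => l _.
by rewrite gE subr0 lift0 mulrA [expR _ * _]mulrC.
Qed.
End erlang_convolution.

(** * Distribution function of a sum of independent exponential variables *)

Lemma integral_exponential (d : measure_display) (T : measurableType d)
    (R : realType) (P : probability T R) (X : {RV P >-> R}) (rate : R)
    (g : R -> \bar R) :
  0 < rate -> is_exponential P X rate ->
  measurable_fun setT g -> (forall z, (0 <= g z <= 1)%E) ->
  (\int[distribution P X]_z g z =
   \int[lebesgue_measure]_z (g z * (exponential_pdf rate z)%:E))%E.
Proof.
move=> rate0 expX mg g01.
have g0 z : (0 <= g z)%E by have /andP[] := g01 z.
(* [lebesgue_measure] lives on [measurableTypeR R], whose display differs from the
   one of the canonical measurable structure on [R], so the law is retyped *)
pose GR : measurableType _ := measurableTypeR R.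
have mX : measurable_fun setT (X : T -> GR) by exact: (measurable_funPT X).
pose X' : {mfun T >-> GR} := @mfun_Sub _ _ T GR X (mem_set mX).
have mg' : measurable_fun setT (g : GR -> \bar R) by exact: mg.
rewrite ge0_integral_distribution//.
rewrite -(ge0_integral_distribution X' mg')//.
have intf := integrable_exponential_pdf rate0.
apply: (integral_density _ _ _ (distribution P X') lebesgue_measure
  (exponential_pdf rate) intf).
  exact: expX.
apply: (@le_integrable _ GR R (distribution P X') setT measurableT g
  (EFin \o cst 1)) => //.
  by move=> z _; rewrite gee0_abs//= normr1; have /andP[] := g01 z.
exact: finite_measure_integrable_cst.
Qed.

(** The exponential law is asked only below [n], so that the lemma fits the concatenated family,
    whose second block has its own rates. *)
Lemma prob_partial_sum_exponential (d : measure_display) (T : measurableType d)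
    (R : realType) (P : probability T R) (m : nat) (X : 'I_m -> {RV P >-> R})
    (rate : R) (n : nat) :
  mutually_independent P (fun i => X i : T -> R) -> 0 < rate -> (n <= m)%N ->
  (forall i : 'I_m, (i < n)%N -> is_exponential P (X i) rate) ->
  forall x : R, P (partial_sum X n @^-1` `]-oo, x]) =
    (if 0 <= x then erlang_cdf n rate x else 0)%:E.
Proof.
move=> indX rate0; elim: n => [_ _ x|n IH nm expX x].
  have S0 w : partial_sum X 0 w = 0 by rewrite partial_sumE big_pred0.
  case: ifPn => [x0|]; last rewrite -ltNge => x0.
    rewrite /erlang_cdf big_ord0 subr0 -(probability_setT P); congr (P _).
    by apply/seteqP; split => w //= _; rewrite S0 in_itv/=.
  rewrite -[RHS](measure0 P); congr (P _).
  by apply/seteqP; split => w //=; rewrite S0 in_itv/= leNgt x0.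
have {}IH := IH (ltnW nm) (fun i ni => expX i (ltnW ni)).
pose S := partial_sum X n.
pose h z : R := if 0 <= x - z then erlang_cdf n rate (x - z) else 0.
rewrite (prob_partial_sumS _ _ _ _ _ _ indX _ nm)//.
have hE z : P (S @^-1` [set s | `]-oo, x]%classic (z + s)]) = (h z)%:E.
  rewrite -IH; congr (P _).
  by apply/seteqP; split => w /=; rewrite !in_itv/= lerBrDl.
under eq_integral do rewrite hE.
(* Being values of a distribution function gives both measurability and the bounds 0 and 1. *)
have hcdf z : (h z)%:E = cdf S (x - z) by rewrite -IH.
have mh : measurable_fun setT (EFin \o h).
  rewrite (_ : EFin \o h = cdf S \o (fun z => x - z)); last exact/funext.
  by apply: measurableT_comp; [exact: cdf_measurable|exact: measurable_funB].
have h01 z : (0 <= (h z)%:E <= 1)%E by rewrite hcdf cdf_ge0 cdf_le1.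
rewrite (integral_exponential _ _ _ _ _ rate)//; last exact: expX.
case: ifPn => [x0|]; last rewrite -ltNge => x0.
  (* The integrand vanishes off [[0, x]]: the density is 0 for [z < 0], and [h z] is 0 for
     [z > x]. *)
  rewrite -erlang_convolution// [RHS]integral_mkcond; apply: eq_integral => z _.
  rewrite patchE/= mem_setE in_itv/=.
  have [z0|z0] := leP 0 z; last by rewrite lt0_exponential_pdf// mule0.
  rewrite exponential_pdfE// /h subr_ge0; case: ifP => //.
  by rewrite mul0e.
apply: integral0_eq => z _.
have [z0|z0] := leP 0 z; last by rewrite lt0_exponential_pdf// mule0.
by rewrite /h ifF ?mul0e//; apply/negbTE; rewrite -ltNge subr_lt0 (lt_le_trans x0).
Qed.

(** * Time to leave the Erlang phase, and mean traversal times *)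

Theorem theorem4 (R : realType) (d : measure_display) (T : measurableType d)
  (P : probability T R) (N k : nat) (lam del lam' : 'I_N -> R)
  (Delta lamE eps p : R)
  (Z : 'I_k -> {RV P >-> R}) (S' : 'I_N -> {RV P >-> R}) :
  (0 < N)%N -> (0 < k)%N ->
  (forall j, 0 < lam j) -> (forall j, 0 <= del j) ->
  (forall j, lam j * del j < 1) ->
  Delta = \sum_(j < N) del j -> 0 < Delta ->
  0 < eps < 1 -> 0 < p < 1 ->
  (* (a) *)
  1 - \sum_(l < k) ((k%:R * (1 - eps)) ^+ l * expR (- (k%:R * (1 - eps)))
                     / (l`!)%:R) = p ->
  (* (b) *)
  lamE = k%:R / Delta ->
  (* (c) *)
  (forall j, lam' j = lam j / (1 - lam j * del j)) ->
  (* CTMC semantics of the fragment: independent exponential sojourn times *)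
  (forall l, is_exponential P (Z l) lamE) ->
  (forall j, is_exponential P (S' j) (lam' j)) ->
  mutually_independent P
    (concat_family (fun l => (Z l : T -> R)) (fun j => (S' j : T -> R))) ->
  (* (i) *)
  P [set w | (\sum_(l < k) Z l w <= Delta * (1 - eps))%R] = p%:E /\
  (* (ii) *)
  ('E_P[(fun w => \sum_(l < k) Z l w + \sum_(j < N) S' j w)%R] =
     (\sum_(j < N) (lam j)^-1)%:E)%E /\
  (forall (d' : measure_display) (T' : measurableType d')
          (P' : probability T' R) (S : 'I_N -> {RV P' >-> R}),
     (forall j, is_exponential P' (S j) (lam j)) ->
     ('E_P'[(fun w => \sum_(j < N) S j w)%R] =
        (\sum_(j < N) (lam j)^-1)%:E)%E).
Proof.
move=> _ k0 lam0 _ lamdel DeltaE Delta0 /andP[eps0 eps1] _ pE lamEE lam'E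
  expZ expS' ind.
have kR0 : 0 < k%:R :> R by rewrite ltr0n.
have lamE0 : 0 < lamE by rewrite lamEE divr_gt0.
have lam'0 j : 0 < lam' j by rewrite lam'E divr_gt0// subr_gt0.
split; [|split].
(* The concatenated family again, now valued in random variables so that partial sums are
   measurable. *)
- pose W (i : 'I_(k + N)) : {RV P >-> R} :=
    match fintype.split i with inl a => Z a | inr b => S' b end.
  have indW : mutually_independent P (fun i => W i : T -> R).
    rewrite (_ : (fun i => _) = concat_family (fun l => Z l : T -> R)
      (fun j => S' j : T -> R))//.
    by apply/funext => i; rewrite /W /concat_family; case: fintype.split.
  have WZ l : W (lshift N l) = Z l by rewrite /W (unsplitK (inl l)).
  have expW (i : 'I_(k + N)) : (i < k)%N -> is_exponential P (W i) lamE.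
    by case: (split_ordP i) => j ->; rewrite ?WZ //= ltnNge leq_addr.
  have := prob_partial_sum_exponential _ _ _ _ _ _ _ k indW lamE0
    (leq_addr N k) expW (Delta * (1 - eps)).
  rewrite mulr_ge0 ?subr_ge0 ?(ltW Delta0) ?(ltW eps1)//.
  (* By (b), [lamE * (Delta * (1 - eps))] is [k%:R * (1 - eps)], so this is (a). *)
  have -> : erlang_cdf k lamE (Delta * (1 - eps)) = p.
    by rewrite /erlang_cdf lamEE mulrA divfK ?gt_eqF.
  have WE w : partial_sum W k w = \sum_(l < k) Z l w.
    rewrite partial_sumE big_split_ord/= [X in _ + X]big_pred0 => [|j].
      by rewrite addr0; apply: eq_big => [l|l _]; rewrite ?ltn_ord ?WZ.
    by rewrite ltnNge leq_addr.
  by move=> <-; congr (P _); apply/seteqP; split => w /=; rewrite in_itv/= WE.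
- have [LZ EZ] := expectation_sum_exponential _ _ _ _ _ Z (fun=> lamE)
    (fun=> lamE0) expZ.
  have [LS ES] := expectation_sum_exponential _ _ _ _ _ S' lam' lam'0 expS'.
  have := expectationD LZ LS; rewrite EZ ES => ->.
  rewrite -EFinD; congr EFin.
  (* The Erlang phase has mean [k%:R / lamE = Delta], whose summands [del j] compensate
     [(lam' j)^-1 = (lam j)^-1 - del j]. *)
  rewrite sumr_const card_ord -mulr_natl lamEE invf_div mulrCA divff ?gt_eqF//.
  rewrite mulr1 DeltaE -big_split; apply: eq_bigr => j _ /=.
  by rewrite lam'E; field; rewrite !gt_eqF// subr_gt0.
- move=> d' T' P' S expS.
  by have [] := expectation_sum_exponential _ _ _ _ _ S lam lam0 expS.
Qed.
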